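(* The following statements are equivalent for every uncountable regular cardinal $\kappa$: (1) $\kappa$ is strongly inaccessible; (2) every ${<}\kappa$-linked partial order of cardinality at most $\kappa$ is $\kappa$-stationarily layered; (3) every ${<}\kappa$-linked partial order is $\kappa$-stationarily layered.
   Context: A partial order $\mathbb{P}$ is ${<}\kappa$-linked if there are $\lambda<\kappa$ and a function $c:\mathbb{P}\to\lambda$ that is injective on antichains of $\mathbb{P}$. A suborder $\mathbb{Q}\subseteq\mathbb{P}$ is a regular suborder if the inclusion map preserves incompatibility and every maximal antichain of $\mathbb{Q}$ is maximal in $\mathbb{P}$. $\mathrm{Reg}_\kappa(\mathbb{P})$ is the set of regular suborders of $\mathbb{P}$ of cardinality less than $\kappa$. $\mathbb{P}$ is $\kappa$-stationarily layered if $\mathrm{Reg}_\kappa(\mathbb{P})$ is stationary in $\mathcal{P}_\kappa(\mathbb{P})$, stationarity in Jech's sense: $S\subseteq\mathcal{P}_\kappa(A)$ is stationary if it meets every $C\subseteq\mathcal{P}_\kappa(A)$ that is $\subseteq$-cofinal and closed under unions of $\subseteq$-increasing chains of length less than $\kappa$. *)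

(* Defs.v *)
From mathcomp Require Import all_boot all_order.
From mathcomp Require Import boolp classical_sets functions cardinality wochoice.

Set Implicit Arguments.
Unset Strict Implicit.
Unset Printing Implicit Defensive.

Local Open Scope classical_set_scope.
Local Open Scope card_scope.
Local Open Scope order_scope.

Definition card_lt T U (A : set T) (B : set U) := (A #<= B) && ~~ (B #<= A).
Notation "A '#<' B" := (card_lt A B)
  (at level 79, format "A  '#<'  B") : card_scope.

(* Ordinals and cardinals are presented as in the von Neumann coding: a
   cardinal is a well-ordered type K, the elements of K are the ordinals
   smaller than K, and an element l is identified with [below l], the set of
   its predecessors. *)

Section Cardinals.
Context {d : Order.disp_t} (K : orderType d).

Definition below (l : K) : set K := [set x | x < l].

(* K is an initial ordinal. *)
Definition is_cardinal : Prop :=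
  well_order (<=%O : rel K) /\ forall l : K, below l #< [set: K].

(* No function from an ordinal l smaller than K is cofinal in K. *)
Definition is_regular : Prop :=
  forall (l : K) (f : K -> K),
    ~ (forall b : K, exists2 x, below l x & b <= f x).

Definition uncountable_regular_cardinal : Prop :=
  [/\ is_cardinal, ~ countable [set: K] & is_regular].

Definition strong_limit : Prop :=
  forall l : K, [set A : set K | A `<=` below l] #< [set: K].

Definition strongly_inaccessible : Prop :=
  uncountable_regular_cardinal /\ strong_limit.

End Cardinals.

Section Stationary.
Context {d : Order.disp_t} (K : orderType d) (A : Type).

Definition Pkappa : set (set A) := [set x | x #< [set: K]].

Definition cofinal_in_Pkappa (C : set (set A)) : Prop :=
  forall x, Pkappa x -> exists2 y, C y & x `<=` y.

(* A chain of length l is given by the values of c on [below l]; the length is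
   required to be nonzero, so that a closed set need not contain set0. *)
Definition closed_in_Pkappa (C : set (set A)) : Prop :=
  forall (l : K) (c : K -> set A),
    below l !=set0 ->
    (forall i, below l i -> C (c i)) ->
    (forall i j, below l i -> below l j -> i <= j -> c i `<=` c j) ->
    C (\bigcup_(i in below l) c i).

Definition stationary (S : set (set A)) : Prop :=
  S `<=` Pkappa /\
  forall C : set (set A), C `<=` Pkappa ->
    cofinal_in_Pkappa C -> closed_in_Pkappa C -> (S `&` C) !=set0.

End Stationary.

Section Suborders.
Context {d : Order.disp_t} {P : porderType d}.
Implicit Types Q A B : set P.

Definition compatible_in Q (p q : P) : Prop :=
  exists2 r, Q r & (r <= p) && (r <= q).

Definition antichain_of Q A : Prop :=
  A `<=` Q /\ forall p q, A p -> A q -> p != q -> ~ compatible_in Q p q.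

Definition maximal_antichain_of Q A : Prop :=
  antichain_of Q A /\ forall B, antichain_of Q B -> A `<=` B -> B = A.

Definition regular_suborder Q : Prop :=
  (forall p q, Q p -> Q q ->
     ~ compatible_in Q p q -> ~ compatible_in [set: P] p q) /\
  (forall A, maximal_antichain_of Q A -> maximal_antichain_of [set: P] A).

End Suborders.

Section Layered.
Context {d : Order.disp_t} (K : orderType d).
Context {d' : Order.disp_t} (P : porderType d').

Definition linked : Prop :=
  exists (l : K) (c : P -> K),
    (forall p, below l (c p)) /\
    (forall A : set P, antichain_of [set: P] A -> set_inj A c).

Definition Reg : set (set P) :=
  [set Q | regular_suborder Q /\ Q #< [set: K]].

Definition stationarily_layered : Prop := stationary K Reg.

End Layered.

(* Main.v *)
(** From (1) to (3): if [c : P -> l] is injective on antichains, then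
    [I p = {c q | q <= p}] is a subset of [l], and [p], [q] are compatible iff
    [I p] meets [I q].  So a suborder [Q] is regular as soon as it contains one
    representative of every value of [I] (there are at most 2^l < kappa of them)
    and a common lower bound of any two of its elements that are compatible in
    [P]; closing off omega times inside a given club produces such a [Q].

    From (2) to (1): if 2^l >= kappa, fix distinct subsets [f x] of [l], for
    [x < kappa].  Conditions are pairs [(s, F)] with [s] a finite set of finite
    partial functions on [l] and [F] a finite subset of kappa; a function added
    to [s] in an extension may not be contained in [f x] for any [x] in [F].
    Conditions with the same [s] are compatible, so the order is
    <kappa-linked.  Let [Q] be of size < kappa and closed under adding
    functions to [s], and let [x] occur in no [F] of [Q].  Every [(s, F)] in [Q]
    can be extended in [Q] by a piece of [f x] that is contained in no [f y],
    [y] in [F], which makes it incompatible with [(0, {x})]; hence [Q] is not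
    regular.

    Cardinal arithmetic below kappa is derived from regularity. *)

Require Import Defs.
From HB Require Import structures.
From mathcomp Require Import all_boot all_order finmap.
From mathcomp Require Import boolp classical_sets functions cardinality.

Set Implicit Arguments.
Unset Strict Implicit.
Unset Printing Implicit Defensive.

Import Order.TTheory.

Local Open Scope classical_set_scope.
Local Open Scope card_scope.

(** * Comparing cardinalities through relations and injections *)

(** Choice turns [R] into a function, which the second hypothesis makes injective on [A]. *)
Lemma card_le_rel T U (A : set T) (B : set U) (R : T -> U -> Prop) :
  (forall a, A a -> exists2 b, B b & R a b) ->
  (forall a a' b, A a -> A a' -> R a b -> R a' b -> a = a') ->
  A #<= B.
Proof.
move=> Rtot Rinj.
have [->|/set0P[a0 Aa0]] := eqVneq A set0; first exact: card_ge0.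
have [b0 Bb0 _] := Rtot _ Aa0.
have [|f fP] := @choice T U (fun a b => A a -> B b /\ R a b).
  move=> a.
  have [Aa|nAa] := pselect (A a); last by exists b0.
  by have [b ? ?] := Rtot _ Aa; exists b.
apply: (@card_le_trans _ _ _ (f @` A)).
  suff : f @` A #= A by rewrite card_eq_le => /andP[].
  apply: inj_card_eq => a a' /set_mem Aa /set_mem Aa' eqf.
  apply: (Rinj a a' (f a)) => //; first by case: (fP a Aa).
  by rewrite eqf; case: (fP a' Aa').
by apply: subset_card_le => _ [a Aa <-]; case: (fP a Aa).
Qed.

(** The default value [u0] makes [U] pointed, so that the injection can be taken total on [T]. *)
Lemma card_le_inj T U (A : set T) (B : set U) (u0 : U) :
  A #<= B -> exists2 f : T -> U, (forall a, A a -> B (f a)) &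
    forall a a', A a -> A a' -> f a = f a' -> a = a'.
Proof.
pose PU := HB.pack_for pointedType U (gen_eqMixin U) (gen_choiceMixin U)
  (isPointed.Build U u0).
move=> /(@pcard_leP T PU A B)[f]; exists f => [a Aa|a a' Aa Aa'].
  exact: (@funS _ _ A B f).
by move=> e; have /= := @inj _ _ _ f; apply => //; apply/mem_set.
Qed.

(** * Cardinal arithmetic below a regular uncountable cardinal *)

Section RegularCardinal.
Context {d : Order.disp_t} (K : orderType d).
Context (regK : uncountable_regular_cardinal K).
Local Open Scope order_scope.

(** Size below kappa, with a bounding ordinal as witness; [small_card_lt] identifies this with
    [#<]. *)
Definition small T (A : set T) : Prop := exists l : K, A #<= below l.

Lemma K_nonempty : [set: K] !=set0.
Proof. by apply/set0P/eqP => K0; case: regK => _ []; rewrite K0. Qed.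

Lemma exists_least (A : set K) : A !=set0 ->
  exists2 m, A m & forall x, A x -> m <= x.
Proof.
case: regK => -[Kwo _] _ _ [x Ax].
have [|m [[Am mlb] _]] := Kwo [pred x | `[< A x >]].
  by exists x; apply/asboolP.
by exists m => [|y Ay]; [exact/asboolP|apply/mlb/asboolP].
Qed.

Lemma lt_wf : well_founded (fun x y : K => x < y).
Proof.
move=> x; apply: contrapT => nx.
have [//|m nm mlb] := @exists_least [set x | ~ Acc (fun x y : K => x < y) x].
  by exists x.
apply: nm; constructor => y ltym; apply: contrapT => ny.
by have := mlb y ny; rewrite leNgt ltym.
Qed.

(** Well-founded recursion for a relational specification. Since [R x] sees only the values below
    [x], the filler [t0] used elsewhere is harmless. *)
Lemma lt_rec T (R : K -> (K -> T) -> T -> Prop) (t0 : T) :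
  (forall x f g t, (forall y, y < x -> f y = g y) -> R x f t -> R x g t) ->
  (forall x f, exists t, R x f t) ->
  exists g : K -> T, forall x, R x g (g x).
Proof.
move=> Rext Rex.
have [H HP] := choice (fun xf : K * (K -> T) => Rex xf.1 xf.2).
pose ext (x : K) (rec : forall y, y < x -> T) (y : K) : T :=
  match pselect (y < x) with left h => rec y h | right _ => t0 end.
pose F x rec := H (x, ext x rec).
have Fext x (f g : forall y, y < x -> T) :
    (forall y p, f y p = g y p) -> F x f = F x g.
  move=> efg; congr (H (_, _)); apply/funext => y; rewrite /ext.
  by case: pselect.
exists (Fix lt_wf (fun=> T) F) => x; rewrite Fix_eq //.
apply: Rext (HP (x, _)) => y ltyx /=; rewrite /ext.
by case: pselect => // h.
Qed.

Lemma below_card_lt (l : K) : ~ ([set: K] #<= below l).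
Proof. by case: regK => -[_ /(_ l)/andP[_ /negP]]. Qed.

(** Distinct elements of [A] are picked by recursion along [K]; getting stuck at [x] would mean that
    the values below [x] exhaust [A], making it small. *)
Lemma nsmall_card_ge T (A : set T) : ~ small A -> [set: K] #<= A.
Proof.
move=> nsmall.
have [x0 _] := K_nonempty.
have AN0 : A !=set0.
  apply/set0P/eqP => A0; apply: nsmall; exists x0.
  by rewrite A0; apply: card_ge0.
have [t0 At0] := AN0.
pose R x (f : K -> T) t := A t /\ forall y, y < x -> f y <> t.
have [|x f|g gP] := @lt_rec T R t0.
- by move=> x f g t efg [At ft]; split=> // y ltyx; rewrite -efg//; apply: ft.
- apply: contrapT => nt; apply: nsmall; exists x.
  apply: (@card_le_rel _ _ _ _ (fun a y => f y = a)) => [a Aa|a a' b _ _ <- //].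
  apply: contrapT => na; apply: nt; exists a; split=> // y yx fy.
  by apply: na; exists y.
apply: (@card_le_rel _ _ _ _ (fun x t => g x = t)) => [x _|x y t _ _].
  by exists (g x) => //; case: (gP x).
move=> <- e; have [//|] := eqVneq x y; rewrite neq_lt => /orP[lt|lt].
  by have [_ /(_ _ lt)] := gP y; rewrite e.
by have [_ /(_ _ lt)] := gP x; rewrite e.
Qed.

Lemma small_card_lt T (A : set T) : small A <-> A #< [set: K].
Proof.
split=> [[l Al]|/andP[_ /negP KA]]; last first.
  by apply: contrapT => /nsmall_card_ge.
apply/andP; split; last first.
  by apply/negP => KA; apply: (@below_card_lt l); apply: card_le_trans KA Al.
by apply: card_le_trans Al (subset_card_le _).
Qed.

Lemma small_le T U (A : set T) (B : set U) : A #<= B -> small B -> small A.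
Proof. by move=> AB [l Bl]; exists l; apply: card_le_trans Bl. Qed.

Lemma smallS T (A B : set T) : A `<=` B -> small B -> small A.
Proof. by move=> /subset_card_le; apply: small_le. Qed.

Lemma small_image T U (f : T -> U) (A : set T) : small A -> small (f @` A).
Proof. by apply: small_le; apply: card_image_le. Qed.

Lemma small_preimage T U (f : T -> U) (A : set U) :
  injective f -> small A -> small (f @^-1` A).
Proof.
move=> finj; apply: small_le.
apply: (@card_le_rel _ _ _ _ (fun a b => f a = b)) => [a Aa|a a' b _ _ <-].
  by exists (f a).
by move=> /finj.
Qed.

Lemma countable_small T (A : set T) : countable A -> small A.
Proof.
move=> cA; apply: contrapT => /nsmall_card_ge KA.
by case: regK => _ + _; apply; apply: sub_countable cA.
Qed.

(** By regularity, the inverse of an injection of [A] into [below l] is not cofinal in [K]. *)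
Lemma small_bounded (A : set K) : small A -> exists b, forall x, A x -> x < b.
Proof.
move=> [l Al].
have [f fl finj] := card_le_inj l Al.
pose g y := xget l [set a | A a /\ f a = y].
have gK a : A a -> g (f a) = a.
  move=> Aa; rewrite /g; case: xgetP => [x _ [Ax]|/(_ a) []] //.
  exact: finj.
case: regK => _ _ /(_ l g) /existsNP[b nb]; exists b => x Ax.
rewrite ltNge; apply/negP => bx; apply: nb; exists (f x); first exact: fl.
by rewrite gK.
Qed.

(* An injection of K into the union would split K into a small family of small,
   hence bounded, pieces; but the bounds would be bounded too. *)
Lemma small_bigcup I T (D : set I) (A : I -> set T) :
  small D -> (forall i, D i -> small (A i)) -> small (\bigcup_(i in D) A i).
Proof.
move=> sD sA; apply: contrapT => /nsmall_card_ge KA.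
have [t0 _] : (\bigcup_(i in D) A i) !=set0.
  apply/set0P/eqP => e; move: KA; rewrite e => /card_le0P K0.
  by case: regK => _ []; rewrite K0.
have [f fA finj] := card_le_inj t0 KA.
have sB i : small [set x | D i /\ A i (f x)].
  have [Di|nDi] := pselect (D i); last first.
    by apply: countable_small; rewrite (_ : mkset _ = set0)// -subset0 => x [].
  apply: small_le (sA i Di).
  apply: (@card_le_rel _ _ _ _ (fun a b => f a = b)) => [a [_ ?]|a a' b _ _ <-].
    by exists (f a).
  by move=> e; apply: finj.
have [b bP] := choice (fun i => small_bounded (sB i)).
have [c cP] := small_bounded (small_image b sD).
(* The bound [c] itself lies in some piece [i], which yields [c < b i < c]. *)
have [i Di Ai] := fA c Logic.I.
have ltcb := bP i c (conj Di Ai).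
have ltbc : b i < c by apply: cP; exists i.
by have := lt_trans ltcb ltbc; rewrite ltxx.
Qed.

Lemma small_setX T U (A : set T) (B : set U) : small A -> small B -> small (A `*` B).
Proof.
move=> sA sB; rewrite (_ : A `*` B = \bigcup_(a in A) (pair a @` B)).
  by apply: small_bigcup => // a _; exact: small_image sB.
apply/seteqP; split=> [[a b] [/= Aa Bb]|_ [a Aa [b Bb <-]]] //=.
by exists a => //; exists b.
Qed.

(** A countable union over the possible lengths. *)
Lemma small_seq (T : eqType) (A : set T) :
  small A -> small [set s : seq T | forall x, x \in s -> A x].
Proof.
move=> sA.
have sn n : small [set s : seq T | size s = n /\ forall x, x \in s -> A x].
  elim: n => [|n IHn].
    have s1 : small [set [::] : seq T] by exact/countable_small/countable1.
    by apply: smallS s1 => s [/size0nil].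
  apply: smallS (small_image (fun xs => xs.1 :: xs.2) (small_setX sA IHn)).
  move=> [[//]|x s] [[sn] As]; exists (x, s) => //; split=> /=.
    by apply: As; rewrite mem_head.
  by split=> // y ys; apply: As; rewrite inE ys orbT.
have sN : small [set: nat] by apply: countable_small.
apply: smallS (small_bigcup sN (fun n _ => sn n)).
by move=> s As; exists (size s).
Qed.

Lemma small_fset (T : choiceType) (A : set T) :
  small A -> small [set s : {fset T} | forall x, x \in s -> A x].
Proof.
move=> sA; apply: (@smallS _ _ ((fun s : {fset T} => enum_fset s) @^-1` _)).
  2: apply: small_preimage (small_seq sA); exact: val_inj.
by [].
Qed.

(* Fibres are embedded one after the other, each one avoiding the small union of
   the images of the previous ones. *)
Lemma card_le_small_fibres T (rho : T -> K) :
  (forall x, small (rho @^-1` [set x])) -> [set: T] #<= [set: K].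
Proof.
move=> srho.
have [x0 _] := K_nonempty.
pose R x (f : K -> T -> K) (h : T -> K) :=
  (forall a b, rho a = x -> rho b = x -> h a = h b -> a = b) /\
  (forall y a b, y < x -> rho a = x -> rho b = y -> h a <> f y b).
have [|x f|g gP] := @lt_rec _ R (fun=> x0).
- move=> x f g h efg [hinj hf]; split=> // y a b yx rax rby.
  by rewrite -efg//; apply: hf.
- pose U := \bigcup_(y in below x) (f y @` (rho @^-1` [set y])).
  have sU : small U.
    apply: small_bigcup => [|y _]; last exact: small_image.
    by exists x.
  (* Otherwise [K] would be covered by two small sets. *)
  have nsU : ~ small (~` U).
    move=> sCU; have : small (\bigcup_b (if b then U else ~` U)).
      apply: small_bigcup => [|[] _] //.
      exact: countable_small.
    rewrite (_ : bigcup _ _ = [set: K]); last first.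
      rewrite -subTset => y _; have [Uy|nUy] := pselect (U y).
        by exists true.
      by exists false.
    by move=> [l]; apply: below_card_lt.
  have le : rho @^-1` [set x] #<= ~` U.
    apply: card_le_trans (nsmall_card_ge nsU).
    have [l le] := srho x; apply: card_le_trans le _.
    exact: subset_card_le.
  have [h hU hinj] := card_le_inj x0 le.
  exists h; split=> [a b|y a b yx ax bY e]; first exact: hinj.
  by apply: (hU a ax); exists y => //; exists b.
apply: (@card_le_rel _ _ _ _ (fun a b => g (rho a) a = b)) => [a _|a a' b _ _ <-].
  by exists (g (rho a) a).
move=> e; have [ginj gdisj] := gP (rho a); have [ginj' gdisj'] := gP (rho a').
have [rr|] := eqVneq (rho a) (rho a').
  by apply: ginj => //; rewrite -e rr.
rewrite neq_lt => /orP[lt|lt]; last by have := gdisj _ _ _ lt erefl erefl; rewrite e.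
by have := gdisj' _ _ _ lt erefl erefl; rewrite e.
Qed.

(* [o] has cofinality omega; reindexing along [N] turns an omega-chain into a
   chain of length [o]. *)
Lemma exists_omega : exists (o : K) (N : K -> nat),
  (forall x y, below o y -> x <= y -> (N x <= N y)%N) /\
  (forall n, exists2 x, below o x & (n <= N x)%N).
Proof.
have [x0 _] := K_nonempty.
have [next nextP] : exists next : K -> K, forall x, x < next x.
  have [|next nextP] := @choice K K (fun x y => x < y); last by exists next.
  move=> x; have [b bP] := small_bounded (countable_small (countable1 x)).
  by exists b; apply: bP.
pose e n := iter n next x0.
have eS n : e n < e n.+1 by exact: nextP.
have elt m n : (m < n)%N -> e m < e n.
  elim: n => // n IHn; rewrite ltnS leq_eqVlt => /predU1P[-> //|/IHn lt].
  exact: lt_trans (eS n).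
have [b bP] := small_bounded (countable_small (card_image_le e [set: nat])).
(* [o] is the supremum of the sequence [e]; for [x < o], [N x] will be the first [n] with
   [x <= e n]. *)
have [|o oP omin] := @exists_least [set x | forall n, e n < x].
  by exists b => n; apply: bP; exists n.
have Nex x : exists n, x < o -> x <= e n /\ forall m, x <= e m -> (n <= m)%N.
  have [xo|_] := boolP (x < o); last by exists 0.
  have /existsNP[n /negP] : ~ forall n, e n < x.
    by move=> /omin; rewrite leNgt xo.
  rewrite -leNgt => xn; have exn : exists n, x <= e n by exists n.
  by have [m xm mmin] := ex_minnP exn; exists m.
have [N NP] := choice Nex.
exists o, N; split=> [x y yo xy|n].
  have [yN _] := NP y yo; have [_ Nmin] := NP x (le_lt_trans xy yo).
  by apply: Nmin; apply: le_trans yN.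
exists (e n); first exact: oP.
have [eN _] := NP (e n) (oP n); rewrite leqNgt; apply/negP => /elt.
by rewrite ltNge eN.
Qed.

Lemma closed_bigcup_nat T (C : set (set T)) (Q : nat -> set T) :
  closed_in_Pkappa K C -> (forall n, C (Q n)) ->
  (forall n, Q n `<=` Q n.+1) -> C (\bigcup_n Q n).
Proof.
move=> Ccl CQ QS.
have QN m n : (m <= n)%N -> Q m `<=` Q n.
  by move=> /subnK <-; elim: (n - m)%N => // k IH; apply: subset_trans (QS _).
have [o [N [Nmono Nunb]]] := exists_omega.
rewrite (_ : \bigcup_n Q n = \bigcup_(x in below o) Q (N x)).
  apply: Ccl => // [|x y _ yo xy]; last exact/QN/Nmono.
  by have [x xo _] := Nunb 0; exists x.
apply/seteqP; split=> [p [n _ Qp]|p [x _ Qp]]; last by exists (N x).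
by have [x xo nN] := Nunb n; exists x => //; apply: QN Qp.
Qed.

End RegularCardinal.

(** * Strong limits: linked orders are stationarily layered *)

Section StrongLimitLayered.
Context {d : Order.disp_t} (K : orderType d).
Context (regK : uncountable_regular_cardinal K) (limK : strong_limit K).
Context {d' : Order.disp_t} (P : porderType d').
Local Open Scope order_scope.

Lemma strong_limit_layered : linked K P -> stationarily_layered K P.
Proof.
move=> [l [c [cl cinj]]]; split=> [Q [] //|C CP Ccof Ccl].
pose comp (p q : P) := compatible_in [set: P] p q.
pose I (p : P) : set K := [set c q | q in [set q | q <= p]].
have compI p q : comp p q <-> (I p `&` I q) !=set0.
  split=> [[r _ /andP[rp rq]]|[_ [[p' p'p <-] [q' q'q e]]]].
    by exists (c r); split; exists r.
  suff [r _ /andP[rp' rq']] : comp p' q'.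
    by exists r => //; rewrite (le_trans rp' p'p) (le_trans rq' q'q).
  have [->|neq] := eqVneq p' q'; first by exists q' => //; rewrite lexx.
  apply: contrapT => ncomp; move/eqP: neq; apply.
  (* If incompatible, the distinct [p'] and [q'] would form an antichain on which [c] is not
     injective. *)
  have anti : antichain_of [set: P] [set p'; q'].
    split=> // x y [->|->] [->|->]; rewrite ?eqxx// => _ //.
    by move=> [r _ /andP[? ?]]; apply: ncomp; exists r => //; apply/andP.
  by apply: (cinj _ anti) => //; apply/mem_set; [left|right].
(* An empty [P] is treated apart, because [rep] and [w] are built with a default value [p0]. *)
have [[p0 _]|P0] := pselect ([set: P] !=set0); last first.
  have noP (p : P) : False by apply: P0; exists p.
  have [|y Cy _] := Ccof set0.
    by apply/(small_card_lt regK)/(countable_small regK).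
  exists y; split=> //; split; last first.
    have -> : y = set0 by rewrite -subset0 => p; case: (noP p).
    by apply/(small_card_lt regK)/(countable_small regK).
  split=> [p|A [_ Amax]]; first by case: (noP p).
  split=> [|B _ _].
    by split=> // p; case: (noP p).
  by apply/seteqP; split=> p; case: (noP p).
(* By [compI], [p] and [rep p] are compatible with the same elements; there are at most as many
   representatives as subsets of [l]. *)
pose rep p := xget p0 [set q | I q = I p].
have IrepE p : I (rep p) = I p.
  by apply: (@xgetPex _ p0 [set q | I q = I p]); exists p.
have repE p q : I p = I q -> rep p = rep q by rewrite /rep => ->.
have Rlt : Pkappa K (range rep).
  apply/(small_card_lt regK).
  apply: small_le (_ : small K [set A : set K | A `<=` below l]); last first.
    exact/(small_card_lt regK).
  apply: (@card_le_rel _ _ _ _ (fun p A => I p = A)) => [p _|].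
    by exists (I p) => // _ [q _ <-]; apply: cl.
  move=> _ _ A [p _ <-] [q _ <-]; rewrite !IrepE => Ip Iq.
  by apply: repE; rewrite Ip.
(* Setting [w (p, p) = p] makes each closing step also an enlargement, so the stages [Q n]
   increase. *)
pose w (pq : P * P) : P :=
  if pq.1 == pq.2 then pq.1
  else xget p0 [set r | (r <= pq.1) && (r <= pq.2)].
have wpp p : w (p, p) = p by rewrite /w eqxx.
have wP p q : comp p q -> (w (p, q) <= p) && (w (p, q) <= q).
  move=> [r _ rpq]; rewrite /w /=; case: eqP => [->|_]; first by rewrite lexx.
  by apply: (@xgetPex _ p0 [set r | (r <= p) && (r <= q)]); exists r.
have stepP Q : exists Q', C Q -> C Q' /\ w @` (Q `*` Q) `<=` Q'.
  have [CQ|nCQ] := pselect (C Q); last by exists Q.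
  have /Ccof [Q' CQ' wQ'] : Pkappa K (w @` (Q `*` Q)).
    have /(small_card_lt regK) sQ := CP Q CQ.
    by apply/(small_card_lt regK)/small_image/small_setX.
  by exists Q'.
have [S SP] := choice stepP.
have [Q0 CQ0 RQ0] := Ccof _ Rlt.
pose Q n := iter n S Q0.
have CQ n : C (Q n) by elim: n => //= n /SP[].
have wQ n p q : Q n p -> Q n q -> Q n.+1 (w (p, q)).
  by move=> Qp Qq; have [_] := SP _ (CQ n); apply; exists (p, q).
have QS n : Q n `<=` Q n.+1 by move=> p Qp; rewrite -(wpp p); apply: wQ.
have QN m n : (m <= n)%N -> Q m `<=` Q n.
  by move=> /subnK <-; elim: (n - m)%N => // k IH; apply: subset_trans (QS _).
exists (\bigcup_n Q n); have CQw := closed_bigcup_nat regK Ccl CQ QS.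
split=> //; split; last exact: CP.
have compQ p q : (\bigcup_n Q n) p -> (\bigcup_n Q n) q -> comp p q ->
    compatible_in (\bigcup_n Q n) p q.
  move=> [m _ Qp] [n _ Qq] /wP wpq; exists (w (p, q)) => //.
  exists (maxn m n).+1 => //; apply: wQ; first exact: QN (leq_maxl _ _) _ Qp.
  exact: QN (leq_maxr _ _) _ Qq.
split=> [p q Qp Qq ncQ cPpq|A [[AQ Aanti] Amax]]; first exact/ncQ/compQ.
have AantiP : antichain_of [set: P] A.
  split=> // p q Ap Aq pq cpq; apply: (Aanti p q Ap Aq pq).
  by apply: compQ => //; apply: AQ.
(* For [b] in [B] outside [A], the element [rep b] lies in the union and, like [b], is incompatible
   with all of [A]; adding it contradicts the maximality of [A] there. *)
split=> // B [_ Banti] AB; apply/seteqP; split=> // b Bb.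
apply: contrapT => nAb.
have bA a : A a -> ~ comp (rep b) a.
  move=> Aa /compI; rewrite IrepE => /compI cba.
  apply: (Banti b a) => //; first exact: AB.
  by apply/eqP => e; apply: nAb; rewrite e.
have nAr : ~ A (rep b).
  by move=> Ar; apply: (bA _ Ar); exists (rep b) => //; rewrite lexx.
have Qr : (\bigcup_n Q n) (rep b) by exists 0 => //; apply: RQ0; exists b.
apply: nAr; rewrite -(Amax (A `|` [set rep b])) => //; first by right.
  split=> [p [/AQ //|->//]|p q].
  have sub x y : compatible_in (\bigcup_n Q n) x y -> comp x y.
    by move=> [r _ h]; exists r.
  move=> [Ap|->] [Aq|->] pq cpq.
  - exact: Aanti cpq.
  - move: cpq => [r _ /andP[rp rb]]; apply: (bA p Ap); exists r => //.
    by rewrite rb.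
  - exact: (bA q Aq (sub _ _ cpq)).
  - by rewrite eqxx in pq.
by move=> x; left.
Qed.

End StrongLimitLayered.

(** * The partial order of conditions *)

(* [R t x] abstracts "the finite partial function [t] is contained in [f x]". *)
Definition condition (T X : choiceType) (R : T -> X -> bool) : Type :=
  ({fset T} * {fset X})%type.

HB.instance Definition _ (T X : choiceType) (R : T -> X -> bool) :=
  Choice.on (condition R).

Section Conditions.
Context (T X : choiceType) (R : T -> X -> bool).
Local Notation condition := (condition R).
Local Open Scope fset_scope.

Definition condition_le (p q : condition) : bool :=
  [&& q.1 `<=` p.1, q.2 `<=` p.2 &
      all (fun t => (t \in q.1) || all (fun x => ~~ R t x) q.2) p.1].

Lemma condition_leP p q : reflect
  [/\ q.1 `<=` p.1, q.2 `<=` p.2 &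
      forall t x, t \in p.1 -> t \notin q.1 -> x \in q.2 -> ~~ R t x]
  (condition_le p q).
Proof.
apply: (iffP and3P) => -[? ? h]; split=> //.
  by move=> t x tp /negPf tq xq; have := allP h t tp; rewrite tq => /allP; apply.
apply/allP => t tp; case: (boolP (t \in q.1)) => //= tq.
by apply/allP => x; apply: h.
Qed.

Fact condition_le_refl : reflexive condition_le.
Proof. by move=> p; apply/condition_leP; split=> // t x ->. Qed.

Fact condition_le_anti : antisymmetric condition_le.
Proof.
move=> [s F] [s' F'] /andP[/condition_leP[/= h1 h2 _] /condition_leP[/= h3 h4 _]].
by congr pair; apply/eqP; rewrite eqEfsubset ?h1 ?h2 ?h3 ?h4.
Qed.

Fact condition_le_trans : transitive condition_le.
Proof.
move=> q p r /condition_leP[pq1 pq2 pq] /condition_leP[qr1 qr2 qr].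
apply/condition_leP; split; [exact: fsubset_trans pq1|exact: fsubset_trans pq2|].
move=> t x tp tr xr; case: (boolP (t \in q.1)) => tq; first exact: qr.
by apply: pq => //; apply: (fsubsetP qr2).
Qed.

Fact condition_display : Order.disp_t. Proof. exact: Order.Disp tt tt. Qed.

HB.instance Definition _ :=
  Order.Le_isPOrder.Build condition_display condition
    condition_le_refl condition_le_anti condition_le_trans.

(** Uniting the second coordinates adds nothing to [s], so the last clause of [condition_le] holds
    vacuously. *)
Lemma condition_compatible (s : {fset T}) (F F' : {fset X}) :
  compatible_in [set: condition] (s, F) (s, F').
Proof.
exists (s, F `|` F') => //; apply/andP; split; apply/condition_leP; split=> //=.
- exact: fsubsetUl.
- by move=> t x ->.
- exact: fsubsetUr.
- by move=> t x ->.
Qed.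
End Conditions.

(** * The order of conditions is linked, of size at most kappa, and not layered *)

Section NotLayered.
Context {d : Order.disp_t} (K : orderType d).
Context (regK : uncountable_regular_cardinal K).
Context (T : choiceType) (R : T -> K -> bool).
Context (sT : small K [set: T]).
Context (Rsep : forall x (F : {fset K}), x \notin F ->
  exists2 t, R t x & forall y, y \in F -> ~~ R t y).
Local Notation P := (condition R).
Local Open Scope fset_scope.

(** The colour of a condition is its first coordinate, coded below [l]. *)
Lemma condition_linked : linked K P.
Proof.
have [l lT] : small K [set: {fset T}].
  by apply: smallS (small_fset regK sT).
have [x0 _] := K_nonempty regK.
have [g gl ginj] := card_le_inj x0 lT.
exists l, (fun p : P => g p.1); split=> [p|A [_ Aanti]]; first exact: gl.
move=> [s F] [s' F'] /set_mem Ap /set_mem Aq /= e.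
have {}e : s = s' by apply: ginj.
subst s'; apply: contrapT => /eqP ne.
exact: (Aanti _ _ Ap Aq ne (condition_compatible _ _ _ _)).
Qed.

(** Each condition is sent to a strict bound of its second coordinate; the fibres are small because
    an ordinal below kappa has few finite subsets. *)
Lemma condition_card_le : [set: P] #<= [set: K].
Proof.
have bnd (p : P) : exists b : K, forall x, x \in p.2 -> (x < b)%O.
  have [b bP] : exists b : K, forall x, [set` p.2]%classic x -> (x < b)%O.
    exact/(small_bounded regK)/(countable_small regK)/finite_set_countable.
  by exists b.
have [rho rhoP] := choice bnd.
apply: (card_le_small_fibres regK (rho := rho)) => b.
have sF : small K [set F : {fset K} | forall x, x \in F -> below b x].
  by apply: small_fset => //; exists b.
have sS : small K [set s : {fset T} | forall x, x \in s -> [set: T]%classic x].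
  exact: small_fset.
apply: smallS (small_setX regK sS sF) => -[s F] /= <-; split=> //= x.
exact: (rhoP (s, F)).
Qed.

Lemma condition_not_layered : ~ stationarily_layered K P.
Proof.
move=> [_ stat].
pose C : set (set P) := [set Q | Pkappa K Q /\
  forall (s : {fset T}) F t, Q (s, F) -> Q (t |` s, F)].
have sFT : small K [set: {fset T}].
  by apply: smallS (small_fset regK sT).
have [|Q Qlt|l c l0 cC cmono|Q [[[_ Qmax] _] [/(small_card_lt regK) sQ QC]]] :=
  stat C.
- by move=> Q [].
(* One step suffices: uniting first coordinates with all finite subsets of [T] already gives a
   closed set. *)
- pose ext (u : P * {fset T}) : P := (u.1.1 `|` u.2, u.1.2).
  exists (ext @` (Q `*` [set: {fset T}]))%classic; last first.
    by move=> p Qp; exists (p, fset0) => //; rewrite /ext fsetU0 -surjective_pairing.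
  split.
    apply/(small_card_lt regK)/small_image/small_setX => //.
    exact/small_card_lt.
  move=> s F t [[p u] [/= Qp _] [<- <-]]; exists (p, t |` u) => //.
  by rewrite /ext /= fsetUCA.
- split=> [|s F t [i il ci]]; last by exists i => //; apply: (cC i il).2.
  apply/(small_card_lt regK)/small_bigcup => // [|i il]; first by exists l.
  exact/(small_card_lt regK)/(cC i il).1.
have [x xQ] : exists x : K, forall p, Q p -> x \notin p.2.
  have : small K (\bigcup_(p in Q) [set` p.2])%classic.
    apply: small_bigcup => // p _.
    exact/(countable_small regK)/finite_set_countable.
  move=> /(small_bounded regK)[x xP]; exists x => p Qp; apply/negP => xp.
  by have := xP x; rewrite ltxx => /(_ (ex_intro2 _ _ p Qp xp)).
pose p0 : P := (fset0, [fset x]).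
(* [D] is dense in [Q], so a maximal one among the antichains inside [D] is a maximal antichain of
   [Q]. Regularity would make it maximal in [P], although [p0] is incompatible with all its
   elements. *)
pose D : set P := [set q | Q q /\ ~ compatible_in [set: P] q p0].
have Ddense q : Q q -> exists2 r, D r & (r <= q)%O.
  case: q => s F Qq; have [t Rtx RtF] := Rsep (xQ _ Qq).
  exists ((t |` s, F) : P); last first.
    apply/condition_leP; split=> //=; first exact: fsubsetU1.
    by move=> t' y; rewrite !inE => /orP[/eqP -> _|->//]; apply: RtF.
  split; first exact: QC.
  (* A common extension would contain [t], which is new over the empty first coordinate of [p0]; the
     order forbids this as [R t x] holds. *)
  move=> [r _ /andP[/condition_leP[/= r1 _ _] /condition_leP[/= _ _ r0]]].
  have := r0 t x; rewrite !inE Rtx eqxx => /(_ _ isT isT).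
  by move=> /(_ (fsubsetP r1 _ (fset1U1 _ _))).
have [F FP FF|A [[[AQ Aanti] AD] Amax]] :=
    @Zorn_bigcup P [set A | antichain_of Q A /\ A `<=` D]%classic.
  split; last by move=> q [A /FP[_ AD]]; apply: AD.
  split=> [q [A /FP[[AQ _] _]]|p q [A FA Ap] [B FB Bq]]; first exact: AQ.
  have [AB|BA] := FF A B FA FB.
    by have [[_ Banti] _] := FP B FB; apply: Banti => //; apply: AB.
  by have [[_ Aanti] _] := FP A FA; apply: Aanti => //; apply: BA.
have : maximal_antichain_of Q A.
  split=> // B [BQ Banti] AB; apply/seteqP; split=> // b Bb.
  apply: contrapT => nAb.
  have [r Dr rb] := Ddense b (BQ b Bb).
  have [Qr _] := Dr.
  have rA a : A a -> ~ compatible_in Q a r.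
    move=> Aa [u Qu /andP[ua ur]].
    apply: (Banti a b (AB _ Aa) Bb); first by apply/eqP => e; apply: nAb; rewrite -e.
    by exists u => //; rewrite ua (le_trans ur rb).
  have nAr : ~ A r by move=> Ar; apply: (rA r Ar); exists r => //; rewrite lexx.
  apply: (Amax (A `|` [set r])%classic).
    by split=> [a Aa|h]; [left|apply: nAr; apply: h; right].
  split; last by move=> a [/AD //|->].
  split=> [a [/AQ //|->]|a a' [Aa|->] [Aa'|->]] //.
  - exact: Aanti.
  - by move=> _; apply: rA.
  - move=> _ [u Qu /andP[ua ur]]; apply: (rA _ Aa').
    by exists u => //; rewrite ua ur.
  - by rewrite eqxx.
move=> /Qmax [[_ AantiP] AmaxP].
have p0p0 : compatible_in [set: P] p0 p0 by exists p0 => //; rewrite lexx.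
(* Maximality in [P] puts [p0] into [A], hence into [D], which is absurd since [p0] is compatible
   with itself. *)
have Ap0 : A p0; last by have [_] := AD _ Ap0.
have <- : (A `|` [set p0])%classic = A; last by right.
apply: AmaxP => [|a Aa]; last by left.
split=> // a a' [Aa|->] [Aa'|->].
- exact: AantiP.
- by move=> _; case: (AD _ Aa).
- move=> _ [u Qu /andP[ua ur]]; have [_ +] := AD _ Aa'; apply.
  by exists u => //; rewrite ua ur.
- by rewrite eqxx.
Qed.

End NotLayered.

(** * Finite pieces of subsets of an ordinal, and the equivalence *)

(* [t] lists finitely many values, i.e. codes a finite partial function on [l]. *)
Definition prescribes {d : Order.disp_t} (K : orderType d) (l : K)
    (f : K -> set K) (t : seq ({x : K | (x < l)%O} * bool)) (x : K) : bool :=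
  all (fun i => `[< f x (val i.1) >] == i.2) t.

(** Induction on [F]: each new [y] contributes a point [z] where [f x] and [f y] differ, listed with
    the value of [f x] there. *)
Lemma prescribes_separates {d : Order.disp_t} (K : orderType d) (l : K)
    (f : K -> set K) :
  (forall x, f x `<=` below l) -> injective f ->
  forall x (F : seq K), x \notin F ->
    exists2 t, prescribes (l := l) f t x &
               forall y, y \in F -> ~~ prescribes f t y.
Proof.
move=> fl finj x; elim=> [|y F IHF]; first by exists [::].
rewrite inE negb_or => /andP[xy /IHF[t tx tF]].
have [z zl fz] : exists2 z, (z < l)%O & ~ (f x z <-> f y z).
  apply: contrapT => nz; move/eqP: xy; apply; apply: finj.
  apply/seteqP; split=> z fz; apply: contrapT => nfz; apply: nz; exists z.
  - exact: (fl _ _ fz).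
  - by move=> [/(_ fz)].
  - exact: (fl _ _ fz).
  - by move=> [_ /(_ fz)].
exists ((exist _ z zl, `[< f x z >]) :: t) => /=.
  by rewrite /prescribes /= eqxx.
move=> y'; rewrite inE => /predU1P[->|/tF nt]; rewrite /prescribes /= negb_and.
  apply/orP; left; apply/negP => /eqP e; apply: fz.
  by split=> ?; apply/asboolP; [rewrite e|rewrite -e]; apply/asboolP.
by rewrite nt orbT.
Qed.

Lemma layered_strong_limit {d : Order.disp_t} (K : orderType d) :
  uncountable_regular_cardinal K ->
  (forall (d' : Order.disp_t) (P : porderType d'),
    linked K P -> [set: P] #<= [set: K] -> stationarily_layered K P) ->
  strong_limit K.
Proof.
move=> regK layered l; apply/(small_card_lt regK).
apply: contrapT => /(nsmall_card_ge regK) Kle.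
have [f fl finj] := card_le_inj set0 Kle.
pose T := {x : K | (x < l)%O}.
have sT : small K [set: seq (T * bool)].
  have sl : small K [set: T].
    exists l; apply: (@card_le_rel _ _ _ _ (fun a b => val a = b)) => [a _|].
      by exists (val a) => //; exact: (valP a).
    by move=> a a' b _ _ <- /val_inj.
  have sb : small K [set: bool] by apply: countable_small.
  by apply: smallS (small_seq regK (small_setX regK sl sb)).
have Rsep x (F : {fset K}) : x \notin F ->
    exists2 t, prescribes (l := l) f t x &
               forall y, y \in F -> ~~ prescribes f t y.
  apply: prescribes_separates => [y|y y']; first exact: fl.
  exact: finj.
apply: (condition_not_layered regK sT Rsep); apply: layered.
  exact: condition_linked.
exact: condition_card_le.
Qed.

Theorem theorem1p10 (d : Order.disp_t) (K : orderType d) :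
  uncountable_regular_cardinal K ->
  [<-> strongly_inaccessible K;
       forall (d' : Order.disp_t) (P : porderType d'),
         linked K P -> [set: P] #<= [set: K] -> stationarily_layered K P;
       forall (d' : Order.disp_t) (P : porderType d'),
         linked K P -> stationarily_layered K P].
Proof.
move=> regK; tfae=> [[_ limK] d' P lP _|layered d' P lP|layered].
- exact: strong_limit_layered.
(* Orders of arbitrary size are reached by first deriving the strong limit property. *)
- exact: (strong_limit_layered regK (layered_strong_limit regK layered)).
- by split=> //; apply: layered_strong_limit => // d' P lP _; apply: layered.
Qed.
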